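(* The decision problem 5th MIL$_{MIZ}$ is solvable in polynomial time.
   Context: Let $G=\langle V,E\rangle$ be a finite directed acyclic graph (DAG). A topological sorting of $G$ is a bijection $\tau:V\to\{1,\dots,|V|\}$ with $\tau(u)<\tau(v)$ for every arc $\langle u,v\rangle\in E$. 5th MIL$_{MIZ}$: Instance: a DAG $G=\langle V,E\rangle$, a subset $E_1\subseteq E$, and a positive integer $K\le|V|$. Question: is there a topological sorting $\tau$ of $G$ such that the set $\{v\in V:\exists u\in V\ (\langle v,u\rangle\in E_1\wedge(\tau(u)-\tau(v)>1\ \vee\ \exists w\in V\ \langle v,w\rangle\in E\setminus E_1))\}$ has size at most $K$? *)

(* Defs.v *)
From mathcomp Require Import all_boot.
Set Implicit Arguments. Unset Strict Implicit. Unset Printing Implicit Defensive.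

(* An instance: vertex set V = 'I_n (vertices labelled 0..n-1), the arc *)
(* set E and the subset E1 given as lists of pairs of labels, and K.    *)

Record instance := Instance {
  inst_n  : nat;
  inst_E  : seq (nat * nat);
  inst_E1 : seq (nat * nat);
  inst_K  : nat }.

Definition arcs (n : nat) (A : seq (nat * nat)) : rel 'I_n :=
  fun x y => (val x, val y) \in A.
Arguments arcs : clear implicits.

Definition acyclic (T : finType) (e : rel T) : bool :=
  ~~ [exists x, exists y, e x y && connect e y x].

Definition valid_instance (I : instance) : Prop :=
  let n := inst_n I in
  [/\ all (fun p => (p.1 < n) && (p.2 < n)) (inst_E I),
      acyclic (arcs n (inst_E I)),
      all (fun p => p \in inst_E I) (inst_E1 I),
      0 < inst_K I & inst_K I <= n].

Definition topological_sorting (n : nat) (e : rel 'I_n) (tau : 'I_n -> nat) : Prop :=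
  [/\ injective tau,
      (forall v, 1 <= tau v <= n) &
      (forall u v, e u v -> tau u < tau v)].
(* (injective + range {1..n} on a set of size n = bijection onto {1..n}) *)

Definition bad_set (I : instance) (tau : 'I_(inst_n I) -> nat) : {set 'I_(inst_n I)} :=
  let e  := arcs (inst_n I) (inst_E I) in
  let e1 := arcs (inst_n I) (inst_E1 I) in
  [set v | [exists u, e1 v u &&
              ((tau v + 1 < tau u)
               || [exists w, e v w && ~~ e1 v w])]].

Arguments bad_set : clear implicits.
Arguments topological_sorting : clear implicits.

Definition MIL5_yes (I : instance) : Prop :=
  exists tau : 'I_(inst_n I) -> nat,
    topological_sorting (inst_n I) (arcs (inst_n I) (inst_E I)) tau /\
    #|bad_set I tau| <= inst_K I.

Inductive sym := One | Sep | Hash.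

Definition enc_nat (k : nat) : seq sym := rcons (nseq k One) Sep.
Definition enc_pairs (A : seq (nat * nat)) : seq sym :=
  flatten [seq enc_nat p.1 ++ enc_nat p.2 | p <- A].
Definition encode (I : instance) : seq sym :=
  enc_nat (inst_n I) ++ [:: Hash] ++ enc_pairs (inst_E I) ++ [:: Hash]
  ++ enc_pairs (inst_E1 I) ++ [:: Hash] ++ enc_nat (inst_K I).

(* Deterministic single-tape Turing machines (two-way infinite tape).   *)

Inductive dir := DL | DR | DS.

Record TM := {
  tm_state : finType;
  tm_gamma : finType;
  tm_blank : tm_gamma;
  tm_input : sym -> tm_gamma;
  tm_start : tm_state;
  tm_acc   : tm_state;
  tm_rej   : tm_state;
  tm_delta : tm_state -> tm_gamma -> tm_state * tm_gamma * dir }.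

(* configuration: state, left part (reversed, nearest first), head, right part *)
Definition config (M : TM) : Type :=
  (tm_state M * seq (tm_gamma M) * tm_gamma M * seq (tm_gamma M))%type.

Definition tm_halted (M : TM) (q : tm_state M) : bool :=
  (q == tm_acc M) || (q == tm_rej M).

Definition tm_step (M : TM) (c : config M) : config M :=
  let: (q, l, a, r) := c in
  if tm_halted q then c else
  let: (q', b, d) := tm_delta q a in
  match d with
  | DS => (q', l, b, r)
  | DL => match l with
          | [::] => (q', [::], tm_blank M, b :: r)
          | x :: l' => (q', l', x, b :: r)
          end
  | DR => match r with
          | [::] => (q', b :: l, tm_blank M, [::])
          | x :: r' => (q', b :: l, x, r')
          end
  end.

Definition tm_init (M : TM) (w : seq sym) : config M :=
  match w with
  | [::] => (tm_start M, [::], tm_blank M, [::])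
  | x :: w' => (tm_start M, [::], tm_input M x, map (tm_input M) w')
  end.

Definition tm_run (M : TM) (t : nat) (w : seq sym) : config M :=
  iter t (@tm_step M) (tm_init M w).

Definition cfg_state (M : TM) (c : config M) : tm_state M :=
  let: (q, _, _, _) := c in q.

Definition decides_in_poly_time (M : TM) (valid yes : instance -> Prop) : Prop :=
  exists c k : nat, forall I, valid I ->
    exists t, t <= c * (size (encode I)).+1 ^ k /\
      tm_halted (cfg_state (tm_run M t (encode I))) /\
      (cfg_state (tm_run M t (encode I)) = tm_acc M <-> yes I).

Definition polynomial_time_solvable (valid yes : instance -> Prop) : Prop :=
  exists M : TM, decides_in_poly_time M valid yes.

(* Main.v *)
Require Import Defs.
From HB Require Import structures.
From mathcomp Require Import all_boot zify.

(** A vertex with an outgoing [E1]-arc can fail to be bad only if it has a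
    single out-neighbour [u], reached by an [E1]-arc and placed right after it;
    at most one vertex can be placed right before [u].  Conversely, choose for
    every such [u] one such in-neighbour: the chosen arcs form disjoint chains
    that no arc leaves except at their last vertex, so that all chains can
    simultaneously be made contiguous in a topological sorting.  Hence the
    minimal size of the bad set is the number of sources of [E1]-arcs minus the
    number of heads [u] of [E1]-arcs that are the only arc out of their source.

    The inequality between these numbers is decided by a Turing machine that
    only sweeps over its input like a Mealy machine and rewinds.  It stores four
    counters [u], [v], [a], [b] as marks: in every unary block, the letter of
    index [i] (the separator included) carries a mark for a counter [r] iff
    [i < r].  One sweep can then compare all blocks with all counters, and
    increment or reset counters. *)

Set Implicit Arguments. Unset Strict Implicit. Unset Printing Implicit Defensive.

(** * The minimal number of bad vertices *)

(** Distinct multiples of [t.+1] differ by more than [t], so an offset of at most [t] cannot bridge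
    the gap. This compares keys of different chains. *)
Lemma ltn_mul_offset s s' t d d' : s < s' -> d' <= t ->
  s * t.+1 - d < s' * t.+1 - d'.
Proof.
move=> lt_s le_d; have : s.+1 * t.+1 <= s' * t.+1 by rewrite leq_mul2r lt_s orbT.
by rewrite mulSn; lia.
Qed.

(** * Positions of vertices under an injective key *)

Section Ranking.
Variables (T : finType) (key : T -> nat).
Hypothesis key_inj : injective key.

Definition ranking (v : T) : nat := #|[set w | key w <= key v]|.

Lemma ranking_lt u v : key u < key v -> ranking u < ranking v.
Proof.
move=> lt_uv; apply: proper_card; apply/properP; split.
  by apply/subsetP => w; rewrite !inE => /leq_trans; apply; exact: ltnW.
by exists v; rewrite !inE // -ltnNge.
Qed.

Lemma ranking_inj : injective ranking.
Proof.
move=> u v eq_uv; apply: key_inj.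
by case: (ltngtP (key u) (key v)) => // /ranking_lt; rewrite eq_uv ltnn.
Qed.

Lemma ranking_gt0 v : 0 < ranking v.
Proof. by apply/card_gt0P; exists v; rewrite inE. Qed.

Lemma ranking_max v : ranking v <= #|T|.
Proof. exact: max_card. Qed.

(** No key lies strictly between, so the set counted for [v] gains only [v]: contiguous keys give
    contiguous positions. *)
Lemma ranking_succ u v : key v = (key u).+1 -> ranking v = (ranking u).+1.
Proof.
move=> eq_vu; rewrite /ranking.
have -> : [set w | key w <= key v] = v |: [set w | key w <= key u].
  apply/setP=> w; rewrite !inE eq_vu leq_eqVlt ltnS -eq_vu.
  by rewrite (inj_eq key_inj).
by rewrite cardsU1 inE eq_vu ltnn.
Qed.

End Ranking.

(** * Lower bound on the bad set *)

Section MinimalBadSet.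
Variables (n : nat) (e e1 : rel 'I_n).
Hypothesis e1_sub : subrel e1 e.

Definition bad (tau : 'I_n -> nat) : {set 'I_n} :=
  [set v | [exists u, e1 v u &&
              ((tau v + 1 < tau u) || [exists w, e v w && ~~ e1 v w])]].

Definition sources1 : {set 'I_n} := [set v | [exists u, e1 v u]].

Definition sole_arc (v u : 'I_n) : bool :=
  e1 v u && [forall w, e v w ==> (w == u)].

Definition sole_targets : {set 'I_n} := [set u | [exists v, sole_arc v u]].

Lemma sole_arcP v u w : sole_arc v u -> e v w -> w = u.
Proof. by case/andP=> _ /forallP/(_ w)/implyP H /H/eqP. Qed.

(** All arcs out of a good source are [e1]-arcs to the next position, so there is only one. Its head
    is a sole target, and the position of the head determines the source. *)
Lemma sources1_le_bad tau : topological_sorting n e tau ->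
  #|sources1| <= #|bad tau| + #|sole_targets|.
Proof.
case=> tau_inj _ tau_mono.
rewrite -(cardsID (bad tau) sources1); apply: leq_add.
  by rewrite subset_leq_card // subsetIr.
(* The default is never taken on a source of an [e1]-arc. *)
pose f v := odflt v [pick u | e1 v u].
have fP v : v \in sources1 :\: bad tau ->
    [/\ sole_arc v (f v) & tau (f v) = (tau v).+1].
  rewrite !inE => /andP[/existsPn good /existsP[u vu]].
  have succ w : e1 v w -> tau w = (tau v).+1.
    move=> vw; have := good w; rewrite vw /= negb_or => /andP[le_w _].
    by have := tau_mono _ _ (e1_sub vw); lia.
  have all1 w : e v w -> e1 v w.
    have := good u; rewrite vu negb_or /= => /andP[_ /existsPn/(_ w)].
    by rewrite negb_and negbK => /orP[/negbTE->|].
  have vf : e1 v (f v).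
    by rewrite /f; case: pickP => [//|/(_ u)]; rewrite vu.
  split; last exact: succ.
  rewrite /sole_arc vf; apply/forallP => w; apply/implyP => /all1 vw.
  by apply/eqP/tau_inj; rewrite (succ _ vw) (succ _ vf).
rewrite -(@card_in_imset _ _ f) => [|v w /fP[_ fv] /fP[_ fw] eq_f].
  apply: subset_leq_card; apply/subsetP => _ /imsetP[v /fP[sv _] ->].
  by rewrite inE; apply/existsP; exists v.
by apply: tau_inj; apply: succn_inj; rewrite -fv -fw eq_f.
Qed.

(** The in-neighbour to be placed right before [u]. The partial inverse of [chosen] is
    [next_in_chain]; both are injective where defined, so the chosen arcs form disjoint paths. *)
Definition chosen (u : 'I_n) : option 'I_n := [pick v | sole_arc v u].
Definition next_in_chain (v : 'I_n) : option 'I_n :=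
  [pick u | chosen u == Some v].

Lemma chosenP u v : chosen u = Some v -> sole_arc v u.
Proof. by rewrite /chosen; case: pickP => // w sw [<-]. Qed.

Lemma chosen_inj u u' v : chosen u = Some v -> chosen u' = Some v -> u = u'.
Proof.
move=> /chosenP uv /chosenP /andP[/e1_sub vu' _].
by rewrite (sole_arcP uv vu').
Qed.

Lemma next_in_chainP v u : next_in_chain v = Some u <-> chosen u = Some v.
Proof.
rewrite /next_in_chain; case: pickP => [w /eqP cw|no].
  by split=> [[<-]//|cu]; rewrite (chosen_inj cw cu).
by split=> // cu; have := no u; rewrite cu eqxx.
Qed.

Lemma next_in_chain_inj v w u :
  next_in_chain v = Some u -> next_in_chain w = Some u -> v = w.
Proof. by move=> /next_in_chainP cv /next_in_chainP; rewrite cv => -[]. Qed.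

(** * A topological sorting with contiguous chains *)

Hypothesis e_acyclic : acyclic e.

(** The number of ancestors ([v] included) increases along arcs; the label, a last digit in base
    [n], breaks ties. *)
Definition sigma (v : 'I_n) : nat := #|[set w | connect e w v]| * n + v.

Lemma sigma_inj : injective sigma.
Proof.
move=> u v eq_uv; apply: val_inj => /=.
have := congr1 (modn^~ n) eq_uv.
by rewrite /sigma /= !modnMDl !modn_small.
Qed.

Lemma sigma_mono u v : e u v -> sigma u < sigma v.
Proof.
move=> uv.
have : #|[set w | connect e w u]| < #|[set w | connect e w v]|.
  apply: proper_card; apply/properP; split.
    apply/subsetP => w; rewrite !inE => /connect_trans; apply.
    exact: connect1.
  (* If [v] were also an ancestor of [u], the arc from [u] to [v] would close a cycle. *)
  exists v; rewrite !inE ?connect0 //; apply: contra e_acyclic => vu.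
  by apply/existsP; exists u; apply/existsP; exists v; rewrite uv.
move=> lt_uv; apply: (@leq_trans (#|[set w | connect e w u]|.+1 * n)).
  by rewrite mulSn addnC ltn_add2l.
by rewrite (leq_trans (leq_mul lt_uv (leqnn n))) // leq_addr.
Qed.

Let top := n * n + n.

Lemma sigma_max v : sigma v <= top.
Proof.
rewrite /sigma /top leq_add ?leq_mul //; last exact: ltnW.
by rewrite (leq_trans (max_card _)) // card_ord.
Qed.

Lemma next_in_chain_e1 v u : next_in_chain v = Some u -> e1 v u.
Proof. by move=> /next_in_chainP/chosenP/andP[]. Qed.

(** Yields the last vertex of the chain and the number of arcs leading to it. *)
Fixpoint chain_end (fuel : nat) (v : 'I_n) : 'I_n * nat :=
  if fuel is k.+1 then
    if next_in_chain v is Some u then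
      let: (h, d) := chain_end k u in (h, d.+1)
    else (v, 0)
  else (v, 0).

(** [sigma] increases along a chain and never exceeds [top], so fuel above [top - sigma v] does not
    run out. *)
Lemma chain_end_fuel k l v : top - sigma v < k -> top - sigma v < l ->
  chain_end k v = chain_end l v.
Proof.
elim: k l v => // k IH [//|l] v ltk ltl /=.
case nv: (next_in_chain v) => [u|//].
have lt_vu := sigma_mono (e1_sub (next_in_chain_e1 nv)).
have := sigma_max u.
by move=> le_u; rewrite (IH l) //; lia.
Qed.

Definition chead v := (chain_end top.+1 v).1.
Definition cdepth v := (chain_end top.+1 v).2.

Lemma chead_next v u : next_in_chain v = Some u -> chead v = chead u.
Proof.
move=> nv; have lt_vu := sigma_mono (e1_sub (next_in_chain_e1 nv)).
have le_u := sigma_max u.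
rewrite /chead (@chain_end_fuel top.+1 top u) /= ?nv; [|lia|lia].
by case: (chain_end top u).
Qed.

Lemma cdepth_next v u : next_in_chain v = Some u -> cdepth v = (cdepth u).+1.
Proof.
move=> nv; have lt_vu := sigma_mono (e1_sub (next_in_chain_e1 nv)).
have le_u := sigma_max u.
rewrite /cdepth (@chain_end_fuel top.+1 top u) /= ?nv; [|lia|lia].
by case: (chain_end top u).
Qed.

Lemma chead_none v : next_in_chain v = None -> chead v = v.
Proof. by rewrite /chead /= => ->. Qed.

Lemma cdepth_none v : next_in_chain v = None -> cdepth v = 0.
Proof. by rewrite /cdepth /= => ->. Qed.

Lemma sigma_cdepth v : sigma v + cdepth v <= sigma (chead v).
Proof.
have [k] := ubnP (top - sigma v); elim: k v => // k IH v ltk.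
case nv: (next_in_chain v) => [u|]; last first.
  by rewrite chead_none // cdepth_none // addn0.
have lt_vu := sigma_mono (e1_sub (next_in_chain_e1 nv)).
rewrite (chead_next nv) (cdepth_next nv).
have le_u := sigma_max u.
by have := IH u; lia.
Qed.

(** Walking back from a common end is deterministic, because [next_in_chain] is injective. *)
Lemma chead_cdepth_inj v w : chead v = chead w -> cdepth v = cdepth w -> v = w.
Proof.
move dE: (cdepth v) => d; elim: d v w dE => [|d IH] v w dv hvw dw.
  case nv: (next_in_chain v) => [u|]; first by rewrite (cdepth_next nv) in dv.
  case nw: (next_in_chain w) => [u|]; first by rewrite (cdepth_next nw) in dw.
  by move: hvw; rewrite !chead_none.
case nv: (next_in_chain v) => [u|]; last by rewrite cdepth_none in dv.
case nw: (next_in_chain w) => [u'|]; last by rewrite cdepth_none in dw.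
rewrite (cdepth_next nv) in dv; rewrite (cdepth_next nw) in dw.
rewrite (chead_next nv) (chead_next nw) in hvw.
case: dv dw => dv [dw].
by move: nw; rewrite -(IH _ _ dv hvw dw); apply: next_in_chain_inj.
Qed.

(* Chains are laid out contiguously, one after the other in the order of the
   [sigma]-values of their last vertices. *)
Definition chain_key v := sigma (chead v) * top.+1 - cdepth v.

(** The subtraction in [chain_key] does not truncate: the depth is at most [sigma (chead v)]. *)
Lemma chain_keyE v : chain_key v + cdepth v = sigma (chead v) * top.+1.
Proof.
rewrite /chain_key subnK // (leq_trans _ (leq_pmulr _ _)) //.
by rewrite (leq_trans _ (sigma_cdepth v)) // leq_addl.
Qed.

Lemma cdepth_max v : cdepth v <= top.
Proof. by have := sigma_cdepth v; have := sigma_max (chead v); lia. Qed.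

Lemma chain_key_inj : injective chain_key.
Proof.
move=> v w eq_vw.
have eqh : sigma (chead v) = sigma (chead w).
  case: (ltngtP (sigma (chead v)) (sigma (chead w))) => // lt_s.
    by have := ltn_mul_offset (cdepth v) lt_s (cdepth_max w);
       rewrite -/(chain_key v) -/(chain_key w) eq_vw ltnn.
  by have := ltn_mul_offset (cdepth w) lt_s (cdepth_max v);
     rewrite -/(chain_key v) -/(chain_key w) eq_vw ltnn.
apply: chead_cdepth_inj; first exact: sigma_inj.
by apply/eqP; rewrite -(eqn_add2l (chain_key v)) {2}eq_vw !chain_keyE eqh.
Qed.

Lemma chain_key_next v u : next_in_chain v = Some u ->
  chain_key u = (chain_key v).+1.
Proof.
move=> nv; have := chain_keyE v; have := chain_keyE u.
rewrite (chead_next nv) (cdepth_next nv); lia.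
Qed.

(** Inside a chain, [w] must be the successor of [v]. If [v] ends its chain,
    [sigma v < sigma w <= sigma (chead w)] puts the chain of [w] later. *)
Lemma chain_key_mono v w : e v w -> chain_key v < chain_key w.
Proof.
move=> vw; case nv: (next_in_chain v) => [u|].
  have /next_in_chainP/chosenP/sole_arcP/(_ vw) -> := nv.
  by rewrite (chain_key_next nv).
apply: ltn_mul_offset (cdepth_max w); rewrite chead_none //.
apply: leq_trans (sigma_mono vw) _.
by apply: leq_trans (sigma_cdepth w); rewrite leq_addr.
Qed.

Lemma ranking_chain_key_sorting :
  topological_sorting n e (ranking chain_key).
Proof.
split=> [|v|u v uv]; first exact: ranking_inj chain_key_inj.
  by rewrite ranking_gt0 (leq_trans (ranking_max _ _)) // card_ord.
exact: ranking_lt (chain_key_mono uv).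
Qed.

(** Every vertex with a successor in its chain is good, and [chosen] injects the sole targets into
    these vertices. *)
Lemma bad_ranking_le :
  #|bad (ranking chain_key)| + #|sole_targets| <= #|sources1|.
Proof.
pose P := [set v | next_in_chain v].
have badP : bad (ranking chain_key) \subset sources1 :\: P.
  apply/subsetP => v; rewrite !inE => /existsP[u /andP[vu vbad]].
  apply/andP; split; last by apply/existsP; exists u.
  case nv: (next_in_chain v) => [u'|//]; exfalso.
  have sv : sole_arc v u' by apply/chosenP/next_in_chainP.
  have eq_u := sole_arcP sv (e1_sub vu); move: vbad; rewrite eq_u.
  rewrite (ranking_succ chain_key_inj (chain_key_next nv)) addn1 ltnn /=.
  case/existsP=> w /andP[vw /negP[]].
  by rewrite (sole_arcP sv vw) -eq_u.
have leP : #|sole_targets| <= #|P|.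
  pose f u := odflt u (chosen u).
  have fP u : u \in sole_targets -> chosen u = Some (f u).
    rewrite inE => /existsP[v vu]; rewrite /f /chosen.
    by case: pickP => [//|/(_ v)]; rewrite vu.
  rewrite -(@card_in_imset _ _ f (mem sole_targets)) => [|u u' uT uT' eq_f].
    apply: subset_leq_card; apply/subsetP => _ /imsetP[u uT ->].
    by rewrite inE; move/next_in_chainP: (fP u uT) => ->.
  by apply: chosen_inj (fP u uT) _; rewrite eq_f; exact: fP.
have subP : P \subset sources1.
  apply/subsetP => v; rewrite !inE; case nv: (next_in_chain v) => [u|//] _.
  by apply/existsP; exists u; exact: next_in_chain_e1.
apply: leq_trans (leq_add (subset_leq_card badP) leP) _.
by rewrite cardsD (setIidPr subP) subnK // subset_leq_card.
Qed.

End MinimalBadSet.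

Lemma MIL5_yesP (I : instance) : valid_instance I ->
  let e := arcs (inst_n I) (inst_E I) in
  let e1 := arcs (inst_n I) (inst_E1 I) in
  MIL5_yes I <-> #|sources1 e1| <= inst_K I + #|sole_targets e e1|.
Proof.
case=> _ acyc /allP sub _ _ /=.
set e := arcs _ _ in acyc *; set e1 := arcs _ _.
have e1_sub : subrel e1 e by move=> x y; exact: sub.
split=> [[tau [tauP le_bad]]|le_card].
  apply: leq_trans (sources1_le_bad e1_sub tauP) _.
  by rewrite leq_add2r.
exists (ranking (chain_key e e1)); split.
  exact: ranking_chain_key_sorting.
have := leq_trans (bad_ranking_le e1_sub acyc) le_card.
by rewrite leq_add2r.
Qed.

(** * A sweeping Turing machine *)

Definition quad (T : Type) : Type := (T * T * T * T)%type.

Definition letter : Type := (option bool * quad bool)%type.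

Definition marks (r : quad nat) (i : nat) : quad bool :=
  let: (u, v, a, b) := r in (i < u, i < v, i < a, i < b).

Definition block (r : quad nat) (k : nat) : seq letter :=
  rcons [seq (Some true, marks r i) | i <- iota 0 k] (Some false, marks r k).

Definition no_marks : quad bool := (false, false, false, false).
Definition hash : letter := (None, no_marks).

Definition pair_blocks (r : quad nat) (A : seq (nat * nat)) : seq letter :=
  flatten [seq block r p.1 ++ block r p.2 | p <- A].

Definition tape (r : quad nat) (I : instance) : seq letter :=
  block r (inst_n I) ++ [:: hash] ++ pair_blocks r (inst_E I) ++ [:: hash]
  ++ pair_blocks r (inst_E1 I) ++ [:: hash] ++ block r (inst_K I).

Definition letter_of_sym (x : sym) : letter :=
  (match x with One => Some true | Sep => Some false | Hash => None end,
   no_marks).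

Lemma letters_encode (I : instance) :
  map letter_of_sym (encode I) = tape (0, 0, 0, 0) I.
Proof.
have enc k : map letter_of_sym (enc_nat k) = block (0, 0, 0, 0) k.
  rewrite /enc_nat /block map_rcons; congr rcons.
  (* With all counters zero the marks do not depend on the index, so the start of [iota] can be
     generalized. *)
  by move: {5}0 => i; elim: k i => //= k IH i; rewrite (IH i.+1).
have encp A : map letter_of_sym (enc_pairs A) = pair_blocks (0, 0, 0, 0) A.
  elim: A => //= p A IH; rewrite /enc_pairs /= !map_cat !enc.
  by rewrite [X in _ ++ X]IH.
by rewrite /encode !map_cat !enc !encp.
Qed.

Lemma size_tape (r : quad nat) (I : instance) :
  size (tape r I) = size (encode I).
Proof.
rewrite -(size_map letter_of_sym) letters_encode.
have szb s k : size (block s k) = k.+1.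
  by rewrite size_rcons size_map size_iota.
have szp A s s' : size (pair_blocks s A) = size (pair_blocks s' A).
  by elim: A => //= p A IH; rewrite /pair_blocks /= !size_cat !szb IH.
by rewrite /tape !size_cat !szb (szp _ _ (0, 0, 0, 0)) (szp (inst_E1 I) _ (0, 0, 0, 0)).
Qed.

(** * Updating and testing counters in one sweep *)

Inductive op := Keep | Incr | Zero.

Definition op_reg (o : op) (r : nat) : nat :=
  match o with Keep => r | Incr => r.+1 | Zero => 0 end.

(* [s] records whether an unmarked letter precedes in the current block. *)
Definition op_mark (o : op) (m s : bool) : bool :=
  match o with Keep => m | Incr => m || ~~ s | Zero => false end.

(** The first unmarked letter has index [r]; an increment marks exactly this letter. *)
Lemma op_markE o r i : op_mark o (i < r) (r < i) = (i < op_reg o r).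
Proof. by case: o => //=; lia. Qed.

Definition op_regs (o : quad op) (r : quad nat) : quad nat :=
  let: (ou, ov, oa, ob) := o in let: (u, v, a, b) := r in
  (op_reg ou u, op_reg ov v, op_reg oa a, op_reg ob b).

Definition op_marks (o : quad op) (m s : quad bool) : quad bool :=
  let: (ou, ov, oa, ob) := o in let: (mu, mv, ma, mb) := m in
  let: (su, sv, sa, sb) := s in
  (op_mark ou mu su, op_mark ov mv sv, op_mark oa ma sa, op_mark ob mb sb).

(* [sect] counts the hashes read so far in binary, [second] tells whether the
   next block is the second component of an arc whose first component has
   value [v] iff [from_v]. *)
Record digest := Digest {
  sect : bool * bool;
  second : bool;
  from_v : bool;
  n_is_u : bool;
  n_is_v : bool;
  a_le_b : bool;
  K_is_b : bool;
  u_source1 : bool;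
  vu_in_E1 : bool;
  v_other_in_E : bool }.

(** Coding by a tuple makes [digest] a finite type, as machine states must be. *)
Definition digest_tuple d :=
  (sect d, second d, from_v d, n_is_u d, n_is_v d, a_le_b d, K_is_b d,
   u_source1 d, vu_in_E1 d, v_other_in_E d).
Definition tuple_digest t :=
  let: (s, p, f, nu, nv, ab, kb, su, vu, vo) := t in
  Digest s p f nu nv ab kb su vu vo.
Lemma digest_tupleK : cancel digest_tuple tuple_digest.
Proof. by case. Qed.
HB.instance Definition _ := Finite.copy digest (can_type digest_tupleK).

Definition digest0 : digest :=
  Digest (false, false) false false false false false false false false false.

Definition read_hash (d : digest) : digest :=
  let: Digest (x, y) p f nu nv ab kb su vu vo := d in
  Digest (x (+) y, ~~ y) p f nu nv ab kb su vu vo.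

Definition read_block (is_u is_v is_b le_ab : bool) (d : digest) : digest :=
  let: Digest s p f nu nv ab kb su vu vo := d in
  match s, p with
  | (false, false), _ => Digest s p f is_u is_v le_ab kb su vu vo
  | (false, true), false => Digest s true is_v nu nv ab kb su vu vo
  | (false, true), true =>
      Digest s false false nu nv ab kb su vu (vo || f && ~~ is_u)
  | (true, false), false => Digest s true is_v nu nv ab kb (su || is_u) vu vo
  | (true, false), true =>
      Digest s false false nu nv ab kb su (vu || f && is_u) vo
  | (true, true), _ => Digest s p f nu nv ab is_b su vu vo
  end.

(** Within the current block: for each counter, whether an unmarked letter has been seen; whether
    all letters marked for [a] are marked for [b]; then the digest. *)
Definition scan : Type := (quad bool * bool * digest)%type.
Definition scan0 (d : digest) : scan := (no_marks, true, d).

(** A block has the value of a counter iff its separator is its first letter unmarked for that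
    counter. *)
Definition scan_letter (s : scan) (g : letter) : scan :=
  let: (seen, le, d) := s in
  let: (su, sv, sa, sb) := seen in
  let: (k, (mu, mv, ma, mb)) := g in
  match k with
  | Some true =>
      (su || ~~ mu, sv || ~~ mv, sa || ~~ ma, sb || ~~ mb, le && (ma ==> mb), d)
  | Some false =>
      scan0 (read_block (~~ mu && ~~ su) (~~ mv && ~~ sv) (~~ mb && ~~ sb)
                        (le && (ma ==> mb)) d)
  | None => scan0 (read_hash d)
  end.

Definition write_letter (o : quad op) (s : scan) (g : letter) : letter :=
  if g.1 is Some k then (g.1, op_marks o g.2 s.1.1) else g.

Fixpoint sweep (o : quad op) (s : scan) (w : seq letter) : scan * seq letter :=
  if w is g :: w' then
    let: (s', w2) := sweep o (scan_letter s g) w' in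
    (s', write_letter o s g :: w2)
  else (s, [::]).

Lemma sweep_cat o s w1 w2 : sweep o s (w1 ++ w2) =
  let: (s1, w1') := sweep o s w1 in
  let: (s2, w2') := sweep o s1 w2 in (s2, w1' ++ w2').
Proof.
elim: w1 s => [|g w1 IH] s /=; first by case: sweep.
by rewrite IH; case: sweep => s1 w1'; case: sweep.
Qed.

(* The state in which the letter of index [i] of a block is reached. *)
Definition scan_at (r : quad nat) (i : nat) (d : digest) : scan :=
  let: (u, v, a, b) := r in
  ((u < i, v < i, a < i, b < i), minn a i <= b, d).

(** The start index [i] is free for the induction. A block of value [k + i] has one letter more than
    its value, hence the truncation of [a] by [minn]. *)
Lemma sweep_block_from o r i k d : let: (u, v, a, b) := r in
  sweep o (scan_at r i d)
    (rcons [seq (Some true, marks r x) | x <- iota i k]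
           (Some false, marks r (k + i))) =
  (scan0 (read_block (k + i == u) (k + i == v) (k + i == b)
                     (minn a (k + i).+1 <= b) d),
   rcons [seq (Some true, marks (op_regs o r) x) | x <- iota i k]
         (Some false, marks (op_regs o r) (k + i))).
Proof.
case: r => [[[u v] a] b]; case: o => [[[ou ov] oa] ob].
elim: k i => [|k IH] i.
  rewrite /= add0n /write_letter /= !op_markE.
  congr (scan0 (read_block _ _ _ _ d), _); lia.
have step : scan_letter (scan_at (u, v, a, b) i d)
    (Some true, marks (u, v, a, b) i) = scan_at (u, v, a, b) i.+1 d.
  by rewrite /scan_at /=; do ![congr pair]; lia.
rewrite addSnnS [iota i k.+1]/= !map_cons !rcons_cons.
by rewrite [LHS]/= -[X in sweep _ X]/(scan_letter (scan_at (u, v, a, b) i d)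
  (Some true, marks (u, v, a, b) i)) step IH /write_letter /= !op_markE.
Qed.

Lemma sweep_block o r k d : let: (u, v, a, b) := r in
  sweep o (scan0 d) (block r k) =
  (scan0 (read_block (k == u) (k == v) (k == b) (minn a k.+1 <= b) d),
   block (op_regs o r) k).
Proof.
have := sweep_block_from o r 0 k d; case: r => [[[u v] a] b].
by rewrite /block /scan_at !ltn0 minn0 !addn0.
Qed.

Lemma sweep_E o r A nu nv ab kb su vu vo : let: (u, v, a, b) := r in
  sweep o (scan0 (Digest (false, true) false false nu nv ab kb su vu vo))
    (pair_blocks r A) =
  (scan0 (Digest (false, true) false false nu nv ab kb su vu
     (vo || has (fun p => (p.1 == v) && (p.2 != u)) A)),
   pair_blocks (op_regs o r) A).
Proof.
case: r => [[[u v] a] b]; rewrite /pair_blocks.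
elim: A vo => [|[x y] A IH] vo /=; first by rewrite orbF.
rewrite !sweep_cat (sweep_block o (u, v, a, b)) /=.
by rewrite (sweep_block o (u, v, a, b)) /= IH /= orbA.
Qed.

Lemma sweep_E1 o r A nu nv ab kb su vu vo : let: (u, v, a, b) := r in
  sweep o (scan0 (Digest (true, false) false false nu nv ab kb su vu vo))
    (pair_blocks r A) =
  (scan0 (Digest (true, false) false false nu nv ab kb
     (su || has (fun p => p.1 == u) A)
     (vu || has (fun p => (p.1 == v) && (p.2 == u)) A) vo),
   pair_blocks (op_regs o r) A).
Proof.
case: r => [[[u v] a] b]; rewrite /pair_blocks.
elim: A su vu => [|[x y] A IH] su vu /=; first by rewrite !orbF.
rewrite !sweep_cat (sweep_block o (u, v, a, b)) /=.
by rewrite (sweep_block o (u, v, a, b)) /= IH /= !orbA.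
Qed.

Definition digest_of (r : quad nat) (I : instance) : digest :=
  let: (u, v, a, b) := r in
  Digest (true, true) false false (inst_n I == u) (inst_n I == v)
    (minn a (inst_n I).+1 <= b) (inst_K I == b)
    (has (fun p => p.1 == u) (inst_E1 I))
    (has (fun p => (p.1 == v) && (p.2 == u)) (inst_E1 I))
    (has (fun p => (p.1 == v) && (p.2 != u)) (inst_E I)).

(** The digest refers to the counters before the sweep, the written tape to those after it. *)
Lemma sweep_tape o r I : sweep o (scan0 digest0) (tape r I) =
  (scan0 (digest_of r I), tape (op_regs o r) I).
Proof.
case: r => [[[u v] a] b]; rewrite /tape.
rewrite sweep_cat (sweep_block o (u, v, a, b)) /=.
rewrite sweep_cat (sweep_E o (u, v, a, b)) /=.
rewrite sweep_cat (sweep_E1 o (u, v, a, b)) /=.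
by rewrite (sweep_block o (u, v, a, b)).
Qed.

(** * The control program *)

Inductive pc :=
  P_K | P_K_incr | P_u | P_src | P_src_incr | P_v | P_arc | P_v_incr
| P_b_incr | P_u_incr | P_end | P_acc | P_rej.

Definition pc_nat (q : pc) : 'I_13 :=
  inord match q with
  | P_K => 0 | P_K_incr => 1 | P_u => 2 | P_src => 3 | P_src_incr => 4
  | P_v => 5 | P_arc => 6 | P_v_incr => 7 | P_b_incr => 8 | P_u_incr => 9
  | P_end => 10 | P_acc => 11 | P_rej => 12 end.
Definition nat_pc (i : 'I_13) : pc :=
  nth P_K [:: P_K; P_K_incr; P_u; P_src; P_src_incr; P_v; P_arc; P_v_incr;
              P_b_incr; P_u_incr; P_end; P_acc; P_rej] i.
Lemma pc_natK : cancel pc_nat nat_pc.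
Proof. by case; rewrite /nat_pc inordK. Qed.
HB.instance Definition _ := Finite.copy pc (can_type pc_natK).

Definition pc_op (q : pc) : quad op :=
  match q with
  | P_K_incr | P_b_incr => (Keep, Keep, Keep, Incr)
  | P_src_incr => (Keep, Keep, Incr, Keep)
  | P_v_incr => (Keep, Incr, Keep, Keep)
  | P_u_incr => (Incr, Zero, Keep, Keep)
  | _ => (Keep, Keep, Keep, Keep)
  end.

(** The program sets [b] to [K]. For each [u < n] it increments [a] if [u] is the source of an
    [E1]-arc, then searches [v < n] for a sole arc from [v] to [u] and increments [b] at the first
    hit. It finally tests [a <= b]. Increments are separate states since a test is decided only at
    the end of a sweep. *)
Definition pc_next (q : pc) (d : digest) : pc :=
  match q with
  | P_K => if K_is_b d then P_u else P_K_incr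
  | P_K_incr => P_K
  | P_u => if n_is_u d then P_end else P_src
  | P_src => if u_source1 d then P_src_incr else P_v
  | P_src_incr => P_v
  | P_v => if n_is_v d then P_u_incr else P_arc
  | P_arc => if vu_in_E1 d && ~~ v_other_in_E d then P_b_incr else P_v_incr
  | P_v_incr => P_v
  | P_b_incr => P_u_incr
  | P_u_incr => P_u
  | P_end => if a_le_b d then P_acc else P_rej
  | P_acc => P_acc
  | P_rej => P_rej
  end.

Definition pc_final (q : pc) : bool :=
  match q with P_acc | P_rej => true | _ => false end.

Lemma pc_finalE q : pc_final q = (q == P_acc) || (q == P_rej).
Proof.
apply/idP/orP => [|[]/eqP-> //].
by case: q => // _; first [by left | by right].
Qed.

(** * From program steps to machine steps *)

Definition prog_step (I : instance) (c : pc * quad nat) : pc * quad nat :=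
  if pc_final c.1 then c
  else (pc_next c.1 (digest_of c.2 I), op_regs (pc_op c.1) c.2).

(** A scan in the state means sweeping right, [None] means rewinding; a blank reverses the
    direction. *)
Definition sweeper : TM := {|
  tm_state := (pc * option scan)%type;
  tm_gamma := option letter;
  tm_blank := None;
  tm_input x := Some (letter_of_sym x);
  tm_start := (P_K, Some (scan0 digest0));
  tm_acc := (P_acc, None);
  tm_rej := (P_rej, None);
  tm_delta q g :=
    match q, g with
    | (p, Some s), Some x =>
        (p, Some (scan_letter s x), Some (write_letter (pc_op p) s x), DR)
    | (p, Some s), None => (pc_next p s.2, None, None, DL)
    | (p, None), Some x => (p, None, Some x, DL)
    | (p, None), None => (p, Some (scan0 digest0), None, DR)
    end |}.

Definition place (q : pc * option scan) (l r : seq (option letter)) :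
    config sweeper :=
  if r is x :: r' then (q, l, x, r') else (q, l, None, [::]).

Lemma sweeper_halted_left q : tm_halted (M := sweeper) (q, None) = pc_final q.
Proof. by rewrite pc_finalE /tm_halted /= !xpair_eqE /= !andbT. Qed.

Lemma sweeper_forward q s w l r :
  iter (size w) (@tm_step sweeper) (place (q, Some s) l (map Some w ++ r)) =
  let: (s', w') := sweep (pc_op q) s w in
  place (q, Some s') (catrev (map Some w') l) r.
Proof.
elim: w s l => //= g w IH s l.
rewrite -iterS iterSr /= /tm_halted /= !xpair_eqE /= !andbF /=.
rewrite -[X in iter _ _ X]/(place (q, Some (scan_letter s g))
   (Some (write_letter (pc_op q) s g) :: l) (map Some w ++ r)).
by rewrite IH; case: sweep.
Qed.

(** [maxn j 1] accounts for the blank visited at the end, which becomes explicit if it was not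
    yet. *)
Lemma sweeper_turn q s x l j :
  tm_step (place (q, Some s) (x :: l) (nseq j None)) =
  place (pc_next q s.2, None) l (x :: nseq (maxn j 1) None).
Proof.
rewrite /tm_halted; case: j => [|j] /=;
by rewrite /tm_halted /= !xpair_eqE /= !andbF /= ?maxn1.
Qed.

Lemma sweeper_backward q x l i r : ~~ pc_final q ->
  iter (size l).+2 (@tm_step sweeper)
    (place (q, None) (map Some l ++ nseq i None) (Some x :: r)) =
  place (q, Some (scan0 digest0)) (nseq (maxn i 1) None)
    (catrev (map Some l) (Some x :: r)).
Proof.
move=> nf; elim: l x r => [|y l IH] x r.
  by case: i => [|i] /=; rewrite !sweeper_halted_left !(negbTE nf) /=
    ?sweeper_halted_left ?(negbTE nf) ?maxn1.
rewrite [size _]/= iterSr.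
rewrite -[tm_step _]/(tm_step (place _ _ _)) /=.
by rewrite sweeper_halted_left (negbTE nf) -[LHS]/(iter (size l).+2 _ (place (q, None)
  (map Some l ++ nseq i None) (Some y :: Some x :: r))) IH.
Qed.

(** The machine halts before rewinding, so in a final state only the state is described; otherwise
    any number of visited blanks may surround the tape. *)
Definition sweeper_at (I : instance) (c : pc * quad nat) (k : config sweeper) :=
  if pc_final c.1 then cfg_state k = (c.1, None) else
  exists i j, k = place (c.1, Some (scan0 digest0)) (nseq i None)
    (map Some (tape c.2 I) ++ nseq j None).

(** Sweeping with the turn, and rewinding, each take one step more than the tape length. *)
Lemma sweeper_simulates_step I c k : sweeper_at I c k ->
  exists t, t <= 2 * (size (encode I)).+1 /\
    sweeper_at I (prog_step I c) (iter t (@tm_step sweeper) k).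
Proof.
case: c => q r; rewrite /sweeper_at /prog_step /=; case fq: (pc_final q).
  by move=> kE; exists 0; rewrite /= fq.
case=> i [j ->].
set w := tape (op_regs (pc_op q) r) I.
set q' := pc_next q _.
have szw : size w = size (encode I) by rewrite size_tape.
have [x [l wE]] : exists x l, w = rcons l x.
  case: (lastP w) szw => [|l x _]; last by exists x, l.
  by rewrite /encode size_cat /enc_nat size_rcons.
have turned : iter (size (encode I)).+1 (@tm_step sweeper)
    (place (q, Some (scan0 digest0)) (nseq i None)
       (map Some (tape r I) ++ nseq j None)) =
    place (q', None) (map Some (rev l) ++ nseq i None)
      (Some x :: nseq (maxn j 1) None).
  rewrite iterS -(size_tape r I) sweeper_forward sweep_tape -/w wE.
  by rewrite catrevE -map_rev rev_rcons /= sweeper_turn.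
case fq': (pc_final q').
  exists (size (encode I)).+1; split; first lia.
  by rewrite turned.
exists ((size (rev l)).+2 + (size (encode I)).+1); split.
  by rewrite -szw wE size_rev size_rcons; lia.
rewrite iterD turned sweeper_backward ?fq' //.
exists (maxn i 1), (maxn j 1).
by rewrite wE catrevE -map_rev revK map_rcons cat_rcons.
Qed.

Lemma sweeper_simulates I m c k : sweeper_at I c k ->
  exists t, t <= m * (2 * (size (encode I)).+1) /\
    sweeper_at I (iter m (prog_step I) c) (iter t (@tm_step sweeper) k).
Proof.
elim: m => [|m IH] ck; first by exists 0.
have [t [le_t tP]] := IH ck.
have [t' [le_t' t'P]] := sweeper_simulates_step tP.
by exists (t' + t); rewrite iterD; split; first by rewrite mulSn leq_add.
Qed.

(** * Step counts of the program loops *)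

Definition reaches (I : instance) (m : nat) (c c' : pc * quad nat) : Prop :=
  exists2 k, k <= m & iter k (prog_step I) c = c'.

Lemma reaches_refl I m c : reaches I m c c.
Proof. by exists 0. Qed.

Lemma reaches_step I m c c' : reaches I m (prog_step I c) c' ->
  reaches I m.+1 c c'.
Proof. by case=> k le_k kE; exists k.+1; rewrite // iterSr. Qed.

Lemma reaches_trans I m1 m2 c1 c2 c3 :
  reaches I m1 c1 c2 -> reaches I m2 c2 c3 -> reaches I (m1 + m2) c1 c3.
Proof.
move=> [k1 le1 <-] [k2 le2 <-]; exists (k2 + k1); last by rewrite iterD.
by rewrite addnC leq_add.
Qed.

Lemma reaches_leq I m1 m2 c c' : m1 <= m2 -> reaches I m1 c c' -> reaches I m2 c c'.
Proof. by move=> le12 [k le_k kE]; exists k => //; exact: leq_trans le12. Qed.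

Definition is_source1 (I : instance) (u : nat) : bool :=
  has (fun p => p.1 == u) (inst_E1 I).
(** The arc runs from [v] to [u]; the head comes first because the loop searches over [v]. *)
Definition is_sole_arc (I : instance) (u v : nat) : bool :=
  has (fun p => (p.1 == v) && (p.2 == u)) (inst_E1 I) &&
  ~~ has (fun p => (p.1 == v) && (p.2 != u)) (inst_E I).
Definition is_sole_target (I : instance) (u : nat) : bool :=
  has (is_sole_arc I u) (iota 0 (inst_n I)).

Lemma reaches_K I :
  reaches I (2 * inst_K I).+1 (P_K, (0, 0, 0, 0)) (P_u, (0, 0, 0, inst_K I)).
Proof.
have loop k b : b + k = inst_K I ->
    reaches I (2 * k).+1 (P_K, (0, 0, 0, b)) (P_u, (0, 0, 0, inst_K I)).
  elim: k b => [|k IH] b bk; apply: reaches_step; rewrite /prog_step /=.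
    by rewrite -bk addn0 eqxx; exact: reaches_refl.
  rewrite (_ : (inst_K I == b) = false); last by lia.
  by rewrite mulnS; apply: reaches_step; rewrite /prog_step /=; apply: IH; lia.
exact: loop.
Qed.

(** Each failed [v] costs three steps. The search stops at the first hit, so [b] grows by a Boolean;
    the final [v'] is immaterial because [P_u_incr] resets it. *)
Lemma reaches_v I u v k a b : v + k = inst_n I ->
  exists v', reaches I (3 * k).+2 (P_v, (u, v, a, b))
    (P_u_incr, (u, v', a, b + has (is_sole_arc I u) (iota v k))).
Proof.
elim: k v => [|k IH] v vk.
  exists v; apply: reaches_step; rewrite /prog_step /=.
  by rewrite -vk !addn0 eqxx; exact: reaches_refl.
rewrite mulnS /=; case sole: (is_sole_arc I u v).
  exists v; apply: reaches_step; rewrite /prog_step /=.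
  rewrite (_ : (inst_n I == v) = false); last by lia.
  apply: reaches_step; rewrite /prog_step /=.
  rewrite -/(is_sole_arc I u v) sole.
  by apply: reaches_step; rewrite /prog_step /= addn1; exact: reaches_refl.
have [|v' IHv] := IH v.+1; first by lia.
exists v'; apply: reaches_step; rewrite /prog_step /=.
rewrite (_ : (inst_n I == v) = false); last by lia.
apply: reaches_step; rewrite /prog_step /=.
rewrite -/(is_sole_arc I u v) sole.
by apply: reaches_step.
Qed.

Lemma reaches_u I u k a b : u + k = inst_n I ->
  reaches I (k * (3 * inst_n I + 6)).+1 (P_u, (u, 0, a, b))
    (P_end, (inst_n I, 0, a + count (is_source1 I) (iota u k),
             b + count (is_sole_target I) (iota u k))).
Proof.
elim: k u a b => [|k IH] u a b uk.
  apply: reaches_step; rewrite /prog_step /=.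
  by rewrite -uk !addn0 eqxx; exact: reaches_refl.
rewrite mulSn -addnS /= !addnA.
apply: (@reaches_trans _ _ _ _ (P_u, (u.+1, 0, a + is_source1 I u,
  b + is_sole_target I u))); last by apply: IH; lia.
rewrite addnC; apply: reaches_step; rewrite /prog_step /=.
rewrite (_ : (inst_n I == u) = false); last by lia.
have inner a' : reaches I (3 * inst_n I).+3 (P_v, (u, 0, a', b))
    (P_u, (u.+1, 0, a', b + is_sole_target I u)).
  have [v' inner'] := @reaches_v I u 0 (inst_n I) a' b (add0n _).
  rewrite -addn1; apply: reaches_trans inner' _.
  by apply: reaches_step; exact: reaches_refl.
apply: reaches_step; rewrite /prog_step /=.
rewrite -/(is_source1 I u); case: is_source1.
  by apply: reaches_step; rewrite /prog_step /= addn1; apply: inner.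
by rewrite addn0; apply: reaches_leq (inner _).
Qed.

Definition answer (I : instance) : bool :=
  count (is_source1 I) (iota 0 (inst_n I)) <=
  inst_K I + count (is_sole_target I) (iota 0 (inst_n I)).

Lemma reaches_answer I : exists r,
  reaches I ((2 * inst_K I).+1 + ((inst_n I * (3 * inst_n I + 6)).+1 + 1))
    (P_K, (0, 0, 0, 0)) ((if answer I then P_acc else P_rej), r).
Proof.
eexists; apply: reaches_trans (reaches_K I) _.
apply: reaches_trans (reaches_u _ _ (add0n _)) _.
(* At most [n] vertices are counted in [a], so the truncation at [n + 1] has no effect. *)
apply: reaches_step; rewrite /prog_step /= add0n (minn_idPl _) //.
  exact: reaches_refl.
by rewrite (leq_trans (count_size _ _)) // size_iota.
Qed.

Lemma sweeper_decides (yes : instance -> Prop) :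
  (forall I, valid_instance I -> yes I <-> answer I) ->
  decides_in_poly_time sweeper valid_instance yes.
Proof.
(* For input length [N]: at most [14 * (N + 1) ^ 2] program steps of at most [2 * (N + 1)] machine
   steps each. *)
move=> yesE; exists 28, 3 => I valI.
have [r [m le_m mE]] := reaches_answer I.
have init : sweeper_at I (P_K, (0, 0, 0, 0)) (tm_init sweeper (encode I)).
  exists 0, 0; rewrite cats0 -letters_encode -map_comp.
  by case: (encode I).
have [t [le_t]] := sweeper_simulates m init; rewrite mE /sweeper_at.
have -> : pc_final (if answer I then P_acc else P_rej) by case: answer.
rewrite -/(tm_run sweeper t (encode I)) => stE.
exists t; split; last rewrite stE.
  apply: leq_trans le_t _.
  (* Both numbers are written in unary. *)
  have : inst_n I + inst_K I < size (encode I).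
    rewrite /encode !size_cat /enc_nat !size_rcons !size_nseq; lia.
  move: (size _) => N lt_N.
  have {}le_m : m <= 14 * (N.+1 * N.+1) by nia.
  by rewrite !expnS expn0; nia.
split; first by rewrite sweeper_halted_left; case: answer.
by rewrite yesE //; case: answer.
Qed.

(** * Correctness of the decision procedure *)

Lemma count_iota_card n (P : pred nat) :
  count P (iota 0 n) = #|[set i : 'I_n | P i]|.
Proof.
rewrite -sum1_count -sum1_card -{1}(subn0 n) -/(index_iota 0 n) big_mkord.
by apply: eq_bigl => i; rewrite inE.
Qed.

(** Validity bounds all labels in the lists by [n], so tests on labels agree with quantification
    over vertices. *)
Lemma answerE (I : instance) : valid_instance I ->
  answer I = (#|sources1 (arcs (inst_n I) (inst_E1 I))| <=
    inst_K I + #|sole_targets (arcs (inst_n I) (inst_E I))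
                              (arcs (inst_n I) (inst_E1 I))|).
Proof.
case=> /allP inE_n _ /allP subE _ _.
have arcE1 x y : (x, y) \in inst_E1 I -> (x < inst_n I) /\ (y < inst_n I).
  by move=> /subE /inE_n /andP.
have soleE (u v : 'I_(inst_n I)) : is_sole_arc I u v =
    sole_arc (arcs (inst_n I) (inst_E I)) (arcs (inst_n I) (inst_E1 I)) v u.
  rewrite /is_sole_arc /sole_arc; congr andb.
    apply/hasP/idP => [[[x y] xy /= /andP[/eqP eq_x /eqP eq_y]]|vu].
      by rewrite /arcs /= -eq_x -eq_y.
    by exists (val v, val u); rewrite //= !eqxx.
  rewrite -all_predC; apply/allP/forallP => [only w|only [x y] xy].
    by apply/implyP => /only /=; rewrite eqxx negbK.
  have /andP[_ /= ltn_y] := inE_n _ xy.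
  apply/negP => /= /andP[/eqP eq_x /negP[]].
  by have := only (Ordinal ltn_y); rewrite /arcs /= -eq_x xy.
rewrite /answer !count_iota_card.
have -> : [set v : 'I_(inst_n I) | is_source1 I v] =
    sources1 (arcs (inst_n I) (inst_E1 I)).
  apply/setP => v; rewrite !inE.
  apply/hasP/existsP => [[[x y] xy /= /eqP eq_x]|[u vu]].
    have [_ ltn_y] := arcE1 _ _ xy.
    by exists (Ordinal ltn_y); move: xy; rewrite eq_x.
  by exists (val v, val u).
suff -> : [set u : 'I_(inst_n I) | is_sole_target I u] =
    sole_targets (arcs (inst_n I) (inst_E I)) (arcs (inst_n I) (inst_E1 I)) by [].
apply/setP => u; rewrite !inE; apply/hasP/existsP => [[v]|[v vu]].
  rewrite mem_iota add0n => /= ltn_v sole.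
  by exists (Ordinal ltn_v); rewrite -soleE.
by exists (val v); rewrite ?soleE // mem_iota add0n ltn_ord.
Qed.

Theorem theorem7p2 : polynomial_time_solvable valid_instance MIL5_yes.
Proof.
exists sweeper; apply: sweeper_decides => I valI.
by rewrite answerE //; exact: MIL5_yesP.
Qed.
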